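(* Let $(X,\rho)$ be a metric space and let $\mathcal{B}$ be a bornology on $X$ with a closed base. Then $$cf(\mathcal B)\cdot 2^{<\delta_0^s(X,\mathcal B)}\le w(\tau^s_{\mathcal B})\le cf(\mathcal B)\cdot 2^{<\delta_1^s(X,\mathcal B)}.$$
   Context: A bornology on a set $X$ is a family $\mathcal B$ of subsets of $X$ that is closed under taking subsets, closed under finite unions, and satisfies $\bigcup\mathcal B=X$. A base of $\mathcal B$ is a subfamily $\mathcal B_0\subset\mathcal B$ such that every $B\in\mathcal B$ is contained in some $B_0\in\mathcal B_0$; $\mathcal B$ has a closed base if it has a base consisting of closed sets (equivalently $\overline B\in\mathcal B$ for all $B\in\mathcal B$). Put $cf(\mathcal B)=\aleph_0+\min\{|\mathcal B_0|:\mathcal B_0\text{ is a base of }\mathcal B\}$. For $B\subset X$ and $\epsilon>0$, $B^\epsilon=\{x\in X:\exists b\in B,\ \rho(x,b)<\epsilon\}$. For $B\subset X$, $$\delta_0^s(B)=\aleph_0+\min\{\mathfrak m:\text{for every closed discrete }D\subset X\text{ there is }\epsilon>0\text{ with }|D\cap B^\epsilon|<\mathfrak m\},$$ and $\delta_0^s(X,\mathcal B)=\sup\{\delta_0^s(\overline B):B\in\mathcal B\}$. A set $S\subset X$ is a shield for $A\subset X$ if for every closed $C\subset X$ with $C\cap S=\emptyset$ there is $\epsilon>0$ with $C\cap A^\epsilon=\emptyset$. For a space $Y$, $\delta(Y)$ is $\aleph_0$ plus the least cardinal $\mathfrak m$ such that every open cover of $Y$ has a subcover of cardinality $<\mathfrak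 m$. For $B\subset X$, $\delta_1^s(B)=\aleph_0+\min\{\delta(S):S\text{ is a closed shield for }B\}$, and $\delta_1^s(X,\mathcal B)=\sup\{\delta_1^s(\overline B):B\in\mathcal B\}$. For cardinals, $\kappa^{<\lambda}=\sup\{\kappa^{\mathfrak m}:\mathfrak m<\lambda\}$. $C(X)$ is the set of continuous functions $X\to\mathbb R$. The topology $\tau^s_{\mathcal B}$ on $C(X)$ is induced by the uniformity with basic entourages $[B,\epsilon]^s=\{(f,g):\exists\delta>0\ \forall x\in B^\delta,\ |f(x)-g(x)|<\epsilon\}$, where $B\in\mathcal B$, $\epsilon>0$. $w(\tau^s_{\mathcal B})$ is the weight of $(C(X),\tau^s_{\mathcal B})$. Convention: all cardinal functions are taken to be infinite, i.e. $\aleph_0$ is added to their value. *)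

(* Defs.v *)
From HB Require Import structures.
From mathcomp Require Import all_boot all_order all_algebra.
From mathcomp Require Import all_classical reals topology.
Set Implicit Arguments.
Unset Strict Implicit.
Unset Printing Implicit Defensive.
Import Order.TTheory GRing.Theory Num.Theory.
Import numFieldTopology.Exports.
Local Open Scope classical_set_scope.
Local Open Scope card_scope.
Local Open Scope ring_scope.

(** * Cardinals

A cardinal is represented by any type of that cardinality: [nat] is aleph_0,
the cardinality of a set [A] is the type [set_type A] (to which [A] coerces),
sums, products and powers are [(k + l)%type], [(k * l)%type] and [m -> k].
A class of cardinals is a predicate [Type -> Prop]. *)

Definition cle (k l : Type) : bool := [set: k] #<= [set: l].
Definition clt (k l : Type) : bool := cle k l && ~~ cle l k.

Definition is_cmin (P : Type -> Prop) (k : Type) : Prop :=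
  P k /\ forall l, P l -> cle k l.

(* [void] is a dummy value for the empty class: see [cminP]. *)
Definition cmin (P : Type -> Prop) : Type :=
  if pselect (exists k, is_cmin P k) is left e then sval (cid e) else void.

(* The supremum of a class that is bounded above (see [csupP]); in Type, as in
   set theory, every family of cardinals indexed by a type is bounded. *)
Definition csup (P : Type -> Prop) : Type :=
  cmin (fun u => forall k, P k -> cle k u).

(* k^{<l} *)
Definition cpowlt (k l : Type) : Type :=
  csup (fun c => exists2 m : Type, clt m l & c = (m -> k)).

Lemma cleP (k l : Type) : (exists f : k -> l, injective f) <-> cle k l.
Proof.
split=> [[f f_inj]|/card_leP/injfunPex[f _ f_inj]].
  apply/card_leP/injfunPex; exists (fun x => to_setT (f (val x))) => //.
  by move=> x y _ _ /(congr1 val)/= /f_inj/val_inj.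
exists (fun x => val (f (to_setT x))) => x y /val_inj /f_inj.
by rewrite !in_setT => /(_ isT isT)/(congr1 val).
Qed.

Lemma cle_refl k : cle k k. Proof. by apply/cleP; exists id. Qed.

Lemma cle_trans l k m : cle k l -> cle l m -> cle k m.
Proof. exact: card_le_trans. Qed.

Lemma cmin_family (I : Type) (F : I -> Type) :
  inhabited I -> exists i, forall j, cle (F i) (F j).
Proof.
case=> i0; pose P (S : set (forall i, F i)) :=
  forall x y, S x -> S y -> forall i, x i = y i -> x = y.
have [|S [PS Smax]] := @Zorn_bigcup _ P.
  move=> C CP Ctot x y [A CA Ax] [B CB By] i xy.
  by have [/(_ _ Ax)|/(_ _ By)] := Ctot _ _ CA CB => ?; [apply: (CP _ CB) xy|
    apply: (CP _ CA) xy].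
have [[i iP]|noi] := pselect (exists i, forall a, exists2 x, S x & x i = a).
  exists i => j; apply/cleP.
  pose g a := sval (cid2 (iP a)).
  have gS a : S (g a) by rewrite /g; case: cid2.
  have gE a : g a i = a by rewrite /g; case: cid2.
  by exists (g^~ j) => a b /(PS _ _ (gS a) (gS b)) gab; rewrite -(gE a) gab gE.
have aP i : exists a : F i, forall x, S x -> x i <> a.
  apply: contrapT => na; apply: noi; exists i => a.
  apply: contrapT => nx; apply: na; exists a => x Sx xa; apply: nx.
  by exists x.
pose y i := sval (cid (aP i)).
have yP x : S x -> forall i, x i <> y i.
  by move=> Sx i; rewrite /y; case: cid => a /=; apply.
exfalso; apply: (Smax (S `|` [set y])).
  split=> [x Sx|/(_ y) Sy]; first by left.
  exact: (yP y (Sy (or_intror erefl)) i0).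
move=> u v [Su|->] [Sv|->] i //; first exact: PS.
- by move/(yP _ Su).
- by move/esym/(yP _ Sv).
Qed.

Lemma cle_total k l : cle k l \/ cle l k.
Proof.
have [|[] kl] := @cmin_family bool (fun b => if b then k else l).
- exact: inhabits true.
- by left; apply: (kl false).
- by right; apply: (kl true).
Qed.

Lemma cminP (P : Type -> Prop) : (exists k, P k) -> is_cmin P (cmin P).
Proof.
move=> [k0 Pk0]; rewrite /cmin; case: pselect => [e|]; first by case: cid.
case; pose Q (S : set k0) := exists2 l, P l & cle l S /\ cle S l.
have Q0 : Q setT.
  exists k0 => //; split; apply/cleP; last by exists val; exact: val_inj.
  by exists to_setT => x y /(congr1 val).
have [|[S SQ] Smin] := @cmin_family {S | Q S} (fun S => sval S).
  by constructor; exists setT.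
have [l Pl [lS Sl]] := SQ; exists l; split=> // m Pm.
have [/cleP[f f_inj]|k0m] := cle_total m k0.
  have mf : cle m (range f) /\ cle (range f) m.
    split; apply/cleP.
      exists (fun x => SigSub (mem_set (imageT f x))) => x y.
      by move/(congr1 val) => /= /f_inj.
    have gP (z : range f) : exists x, f x = val z.
      by have /set_mem[x _ xz] := valP z; exists x.
    exists (fun z => sval (cid (gP z))) => x y.
    by case: cid => a fa; case: cid => b fb /= ab; apply: val_inj;
      rewrite -fa -fb ab.
  have Qf : Q (range f) by exists m.
  exact: cle_trans lS (cle_trans (Smin (exist _ _ Qf)) mf.2).
apply: cle_trans lS (cle_trans _ k0m).
by apply/cleP; exists val; exact: val_inj.
Qed.

Lemma csupP (P : Type -> Prop) : (exists u, forall k, P k -> cle k u) ->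
  (forall k, P k -> cle k (csup P)) /\
  (forall u, (forall k, P k -> cle k u) -> cle (csup P) u).
Proof. exact: cminP. Qed.

(** * Bornologies *)

Record bornology (X : Type) := Bornology {
  bset :> set (set X);
  bornology_subset : forall A B, A `<=` B -> bset B -> bset A;
  (* the union of the empty family is included: set0 belongs to every bornology *)
  bornology_bigcup : forall F : set (set X), finite_set F ->
    F `<=` bset -> bset (\bigcup_(A in F) A);
  bornology_cover : \bigcup_(A in bset) A = setT
}.

Definition bornology_base X (B : bornology X) (B0 : set (set X)) : Prop :=
  B0 `<=` B /\ forall A, bset B A -> exists2 A0, B0 A0 & A `<=` A0.

Definition has_closed_base (X : topologicalType) (B : bornology X) : Prop :=
  exists2 B0, bornology_base B B0 & B0 `<=` closed.

Definition cf X (B : bornology X) : Type :=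
  (nat + cmin (fun k => exists2 B0, bornology_base B B0 & k = B0))%type.

(** * Cardinal functions *)

Definition weight (T : topologicalType) : Type :=
  (nat + cmin (fun k => exists2 U : set (set T), basis U & k = U))%type.

Definition delta (Y : topologicalType) : Type :=
  (nat + cmin (fun m => forall U : set (set Y),
     U `<=` open -> \bigcup_(A in U) A = setT ->
     exists V : set (set Y),
       [/\ V `<=` U, \bigcup_(A in V) A = setT & clt V m]))%type.

Section metric.
Context {R : realType} {X : metricType R}.
Implicit Types (A B C D S : set X) (e : R).

Definition enlargement B e : set X := [set x | exists2 b, B b & mdist x b < e].

Definition closed_discrete D : Prop := closed D /\ D `<=` isolated D.

Definition delta0s B : Type :=
  (nat + cmin (fun m => forall D, closed_discrete D ->
     exists2 e, 0 < e & clt (D `&` enlargement B e) m))%type.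

Definition delta0s_sup (BB : bornology X) : Type :=
  csup (fun k => exists2 B, bset BB B & k = delta0s (closure B)).

Definition shield S A : Prop := forall C, closed C -> C `&` S = set0 ->
  exists2 e, 0 < e & C `&` enlargement A e = set0.

(* [delta S] is taken in the subspace topology of [S]. *)
Definition delta1s B : Type :=
  (nat + cmin (fun k => exists S, [/\ closed S, shield S B & k = delta S]))%type.

Definition delta1s_sup (BB : bornology X) : Type :=
  csup (fun k => exists2 B, bset BB B & k = delta1s (closure B)).

End metric.

(** * The topology of strong uniform convergence on a bornology *)

Section strong.
Context {R : realType} {X : metricType R} (BB : bornology X).

(* C(X), with a phantom argument carrying the bornology *)
Definition CX_strong : Type := let _ := BB in continuousType X R.

HB.instance Definition _ := Choice.copy CX_strong (continuousType X R).

Definition strong_ent_of (B : set X) (e : R) : set (CX_strong * CX_strong) :=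
  [set fg | exists2 d : R, 0 < d & forall x, enlargement B d x ->
    `|(fg.1 : continuousType X R) x - (fg.2 : continuousType X R) x| < e].

Definition strong_ent : set_system (CX_strong * CX_strong) :=
  filter_from [set Be : set X * R | bset BB Be.1 /\ 0 < Be.2]
    (fun Be => strong_ent_of Be.1 Be.2).

Lemma bornology_set0 : bset BB set0.
Proof.
rewrite -(@bigcup_set0 X (set X) id).
by apply: bornology_bigcup => //; exact: finite_set0.
Qed.

Lemma bornology_setU A B : bset BB A -> bset BB B -> bset BB (A `|` B).
Proof.
move=> BA BB'; have -> : A `|` B = \bigcup_(C in [set A; B]) C.
  by rewrite bigcup_setU !bigcup_set1.
by apply: bornology_bigcup => [|_ [->|->]] //; exact: finite_set2.
Qed.

Lemma strong_ent_filter : Filter strong_ent.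
Proof.
apply: filter_from_filter; first by exists (set0, 1); split => //=;
  exact: bornology_set0.
move=> [A d] [B e] /= [BA d0] [BB' e0].
exists (A `|` B, Order.min d e) => /=.
  by split; [exact: bornology_setU | rewrite lt_min d0].
move=> [f g] [r r0 fgr]; split; exists r => //= x [b ? ?].
  by have := fgr x; rewrite lt_min => /(_ _)/andP[|//]; exists b => //; left.
by have := fgr x; rewrite lt_min => /(_ _)/andP[|//]; exists b => //; right.
Qed.

Local Open Scope relation_scope.

Lemma strong_ent_diag A : strong_ent A -> diagonal `<=` A.
Proof.
move=> [[B e] [_ /= e0] BeA] [f g] /= fg; apply: BeA; exists 1 => // x _ /=.
by have /= -> : f = g := fg; rewrite subrr normr0.
Qed.

Lemma strong_ent_inv A : strong_ent A -> strong_ent A^-1.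
Proof.
move=> [[B e] [BB' e0] BeA]; exists (B, e) => // -[f g] [d d0 fg].
by apply: BeA; exists d => //= x /fg /=; rewrite distrC.
Qed.

Lemma strong_ent_split A :
  strong_ent A -> exists2 E, strong_ent E & E \; E `<=` A.
Proof.
move=> [[B e] [/= BB' e0] BeA]; exists (strong_ent_of B (e / 2)).
  by exists (B, e / 2) => //=; rewrite divr_gt0.
move=> [f g] /= [h [d d0 fh] [d' d'0 hg]]; apply: BeA => /=.
exists (Order.min d d'); first by rewrite lt_min d0.
move=> x [b Bb]; rewrite lt_min => /andP[xd xd'] /=.
rewrite [e]splitr -(subrKA ((h : continuousType X R) x)).
apply: le_lt_trans (ler_normD _ _) (ltrD _ _).
  by apply: fh; exists b.
by apply: hg; exists b.
Qed.

HB.instance Definition _ := isUniform.Build CX_strong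
  strong_ent_filter strong_ent_diag strong_ent_inv strong_ent_split.

End strong.

(* Main.v *)
(** Lower bound.  Basic neighbourhoods [[B_V, e_V]] of the zero function inside the
members [V] of a base of the topology give a base of the bornology, made of the closures
of the [B_V], because a tent function around a point outside the closure of [B_V]
vanishes near [B_V].  If [m < delta0s B] is infinite, some closed discrete [D] has at
least [m] points in every enlargement of [B]; then there are [2^m] functions on [D],
any two of which differ by at least 1 at points of [D] arbitrarily close to [B], and
their continuous extensions form a discrete family for [[B, 1]].

Upper bound.  Let [S] be a closed shield of the closure of [B] such that every open
cover of [S] has a subcover smaller than [l = delta1s B].  Functions that are uniformly
close on [S] are close for the entourages of [B], so it suffices to cut the continuous
functions into at most [2^{<l}] classes whose members are uniformly [e]-close on [S].
The delicate case is a limit cardinal [l] of countable cofinality, where [S] may have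
no dense subset smaller than [l]: there one uses that each continuous function
oscillates little on the balls of some fixed radius, except on a closed subset of [S]
that does have a small dense subset. *)

Require Import Defs.
From HB Require Import structures.
From mathcomp Require Import all_boot all_order all_algebra.
From mathcomp Require Import all_classical reals topology.
From mathcomp Require Import ring lra.
Set Implicit Arguments.
Unset Strict Implicit.
Unset Printing Implicit Defensive.
Import Order.TTheory GRing.Theory Num.Theory.
Import numFieldTopology.Exports.
Local Open Scope classical_set_scope.
Local Open Scope ring_scope.

(** * Infinite cardinals *)

(** Most injections below are easier to describe as relations: choice extracts a function, and
    uniqueness on the left makes it injective. *)
Lemma cle_rel (a b : Type) (r : a -> b -> Prop) :
  (forall x, exists y, r x y) -> (forall x x' y, r x y -> r x' y -> x = x') ->
  cle a b.
Proof.
move=> /choice[f fr] r_inj; apply/cleP; exists f => x x' ff.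
by apply: r_inj (fr x) _; rewrite ff; exact: fr.
Qed.

Lemma cle_rel_set (T U : Type) (A : set T) (B : set U) (r : T -> U -> Prop) :
  (forall x, A x -> exists2 y, B y & r x y) ->
  (forall x x' y, A x -> A x' -> B y -> r x y -> r x' y -> x = x') ->
  cle A B.
Proof.
move=> r_tot r_inj; apply: (@cle_rel _ _ (fun x y => r (val x) (val y))).
  move=> [x Ax]; have [y By rxy] := r_tot _ (set_mem Ax).
  by exists (SigSub (mem_set By)).
move=> [x Ax] [x' Ax'] [y By] /= rxy rx'y; apply: val_inj.
by apply: r_inj rxy rx'y; exact: set_mem.
Qed.

Lemma cle_setTl (T : Type) : cle T [set: T].
Proof. by apply/cleP; exists to_setT => x y /(congr1 val). Qed.

Lemma cle_setTr (T : Type) (A : set T) : cle A T.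
Proof. by apply/cleP; exists val; exact: val_inj. Qed.

Lemma cle_rel_setr (T U : Type) (B : set U) (r : T -> U -> Prop) :
  (forall x, exists2 y, B y & r x y) ->
  (forall x x' y, B y -> r x y -> r x' y -> x = x') -> cle T B.
Proof.
move=> r_tot r_inj; apply: (cle_trans (cle_setTl T)).
by apply: (@cle_rel_set _ _ _ _ r) => [x _|x x' y _ _]; [exact: r_tot|exact: r_inj].
Qed.

Lemma cle_rel_setl (T U : Type) (A : set T) (r : T -> U -> Prop) :
  (forall x, A x -> exists y, r x y) ->
  (forall x x' y, A x -> A x' -> r x y -> r x' y -> x = x') -> cle A U.
Proof.
move=> r_tot r_inj; apply: (cle_trans _ (cle_setTr [set: U])).
apply: (@cle_rel_set _ _ _ _ r) => [x /r_tot[y rxy]|x x' y Ax Ax' _].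
  by exists y.
exact: r_inj.
Qed.

Lemma cle_subset (T : Type) (A B : set T) : A `<=` B -> cle A B.
Proof.
by move=> AB; apply: (@cle_rel_set _ _ _ _ eq) => [x /AB|x _ y _ _ _ -> ->//]; exists x.
Qed.

Lemma cle_image (T U : Type) (f : T -> U) (A : set T) : cle (f @` A) A.
Proof.
apply: (@cle_rel_set _ _ _ _ (fun y x => f x = y)) => [_ [x Ax <-]|y y' x].
  by exists x.
by move=> _ _ _ <- <-.
Qed.

Lemma cle_prod (a b c d : Type) : cle a b -> cle c d -> cle (a * c) (b * d).
Proof.
move=> /cleP[f f_inj] /cleP[g g_inj]; apply/cleP.
by exists (fun x => (f x.1, g x.2)) => -[x y] [x' y'] [/f_inj-> /g_inj->].
Qed.

Lemma cle_sum (a b c d : Type) : cle a b -> cle c d -> cle (a + c) (b + d).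
Proof.
move=> /cleP[f f_inj] /cleP[g g_inj]; apply/cleP.
exists (fun x => match x with inl x => inl (f x) | inr x => inr (g x) end).
by move=> [x|x] [y|y] // [] => [/f_inj|/g_inj] ->.
Qed.

Lemma cle_inl (a b : Type) : cle a (a + b).
Proof. by apply/cleP; exists inl => x y []. Qed.

Lemma cle_inr (a b : Type) : cle b (a + b).
Proof. by apply/cleP; exists inr => x y []. Qed.

Lemma cle_count (T : countType) : cle T nat.
Proof. apply/cleP; exists pickle; exact: pcan_inj pickleK. Qed.

Lemma cleNge (a b : Type) : ~ cle a b -> clt b a.
Proof.
move=> ab; rewrite /clt; apply/andP; split; last exact/negP.
by have [] := cle_total a b.
Qed.

Lemma cltP (a b : Type) : clt a b <-> ~ cle b a.
Proof. by split=> [/andP[_ /negP]|/cleNge]. Qed.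

Lemma clt_cle (a b : Type) : clt a b -> cle a b.
Proof. by case/andP. Qed.

Lemma cle_clt_trans (a b c : Type) : cle a b -> clt b c -> clt a c.
Proof.
by move=> ab /cltP bc; apply/cltP => ca; apply: bc; exact: cle_trans ca ab.
Qed.

Lemma clt_cle_trans (a b c : Type) : clt a b -> cle b c -> clt a c.
Proof.
by move=> /cltP ab bc; apply/cltP => ca; apply: ab; exact: cle_trans bc ca.
Qed.

Lemma cantor (a : Type) : clt a (a -> bool).
Proof.
apply/cltP => /cleP[f f_inj].
(* Diagonal set: the codes of sets that do not contain their own code. *)
pose D y := `[< exists2 g : a -> bool, f g = y & g y = false >].
have [DfD|DfD] := boolP (D (f D)).
  have /asboolP[g /f_inj ->] := DfD; by rewrite DfD.
by move/negP: (DfD); apply; apply/asboolP; exists D => //; exact/negbTE.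
Qed.

Lemma cle_fun (a b c d : Type) : inhabited d ->
  cle a b -> cle c d -> cle (a -> c) (b -> d).
Proof.
move=> [d0] /cleP[f f_inj] /cleP[g g_inj].
apply: (@cle_rel _ _ (fun u v => forall x, v (f x) = g (u x))) => [u|u u' v uv u'v].
  (* Off the range of [f] the value of [v] is arbitrary, hence the default [d0]. *)
  exists (fun y => if pselect (exists x, f x = y) is left e
                   then g (u (sval (cid e))) else d0) => x.
  by case: pselect => [e|[]]; [case: cid => /= y /f_inj ->|exists x].
by apply/funext => x; apply: g_inj; rewrite -uv u'v.
Qed.

(** * Squares of infinite cardinals *)

Section square.
Variable k : Type.

Let field (G : set (k * k * k)) : set k := [set x | exists z, G (x, x, z)].

(* [G] is the graph of an injection from [field G * field G] to [field G]. *)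
Let square_graph (G : set (k * k * k)) :=
  [/\ forall p z z', G (p, z) -> G (p, z') -> z = z',
      forall p p' z, G (p, z) -> G (p', z) -> p = p',
      forall x y, field G x -> field G y -> exists z, G (x, y, z) &
      forall x y z, G (x, y, z) -> [/\ field G x, field G y & field G z]].

Let square_graph_cle G : square_graph G -> cle (field G * field G) (field G).
Proof.
move=> [_ G_inj G_tot G_cl].
apply: (@cle_rel _ _ (fun p z => G (val p.1, val p.2, val z))).
  move=> [[x Ax] [y Ay]] /=.
  have [z Gz] := G_tot x y (set_mem Ax) (set_mem Ay).
  have [_ _ Az] := G_cl _ _ _ Gz.
  by exists (SigSub (mem_set Az)).
move=> [x y] [x' y'] z /= Gp Gp'; have [] := G_inj _ _ _ Gp Gp'.
by move=> /val_inj -> /val_inj ->.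
Qed.

(** Zorn's lemma gives a maximal injection from the square of a set [A] to [A] that extends a
    pairing of the natural numbers. If the complement of [A] embeds in [A], then [k] is at most
    twice [A]. Otherwise the complement contains a copy [C] of [A], and the injection extends to the
    square of the union of [A] and [C]. *)
Lemma cle_square : cle nat k -> cle (k * k) k.
Proof.
move=> /cleP[i i_inj].
pose G0 : set (k * k * k) :=
  [set w | exists m n : nat, w = (i m, i n, i (pickle (m, n)))].
have fieldG0 n : field G0 (i n) by exists (i (pickle (n, n))), n, n.
have G0P : square_graph G0.
  split.
  - by move=> _ _ _ [m [n [-> ->]]] [m' [n' [/i_inj -> /i_inj -> ->]]].
  - move=> _ _ _ [m [n [-> ->]]] [m' [n' [-> /i_inj]]].
    by move/(pcan_inj pickleK) => -[-> ->].
  - move=> x y [_ [m [_ [-> _ _]]]] [_ [n [_ [-> _ _]]]].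
    by exists (i (pickle (m, n))), m, n.
  - by move=> x y z [m [n [-> -> ->]]]; split; exact: fieldG0.
(* The condition is put on the union with [G0], so that the empty chain satisfies it too. *)
have [F F_P F_tot|H [HP Hmax]] :=
    @Zorn_bigcup _ [set H | square_graph (G0 `|` H)].
  rewrite /=; set U := G0 `|` _.
  (* Each clause of [square_graph] starts from at most two triples, and these lie in a single square
     graph inside the union. *)
  have U2 w w' : U w -> U w' -> exists G, [/\ square_graph G, G `<=` U, G w & G w'].
    have GU H : F H -> G0 `|` H `<=` U by move=> FH; apply: setUS => u; exists H.
    move=> [Gw|[H FH Hw]] [Gw'|[H' FH' Hw']].
    - by exists G0; split => // u; left.
    - by exists (G0 `|` H'); split; [exact: F_P|exact: GU|left|right].
    - by exists (G0 `|` H); split; [exact: F_P|exact: GU|right|left].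
    - have [HH|HH] := F_tot _ _ FH FH'.
        by exists (G0 `|` H'); split; [exact: F_P|exact: GU|right; exact: HH|right].
      by exists (G0 `|` H); split; [exact: F_P|exact: GU|right|right; exact: HH].
  split.
  - by move=> p z z' /U2 /[apply] -[G [[Gf _ _ _] _]]; exact: Gf.
  - by move=> p p' z /U2 /[apply] -[G [[_ Gi _ _] _]]; exact: Gi.
  - move=> x y [z Uz] [z' Uz'].
    have [G [[_ _ Gt _] GU Gz Gz']] := U2 _ _ Uz Uz'.
    by have [||u /GU ?] := Gt x y; [exists z|exists z'|exists u].
  - move=> x y z Uxyz; have [G [[_ _ _ Gc] GU /Gc[Gx Gy Gz] _]] := U2 _ _ Uxyz Uxyz.
    have fGU u : field G u -> field U u by move=> [v /GU]; exists v.
    by split; exact: fGU.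
move: HP => /= HP; set G := G0 `|` H in HP; set A := field G.
have AA : cle (A * A) A := square_graph_cle HP.
have natA : cle nat A.
  apply: (@cle_rel_setr _ _ _ (fun n x => i n = x)).
    by move=> n; exists (i n) => //; have [z G0z] := fieldG0 n; exists z; left.
  by move=> m n x _ <- /i_inj.
have boolA : cle (bool * A) A.
  apply: cle_trans AA; apply: cle_prod (cle_refl _).
  exact: cle_trans (cle_count bool) natA.
have [CA|/cleP[h h_inj]] := cle_total (~` A) A.
  have kA : cle k A.
    apply: cle_trans boolA; have /cleP[g g_inj] := CA.
    apply: (@cle_rel _ _ (fun x (p : bool * A) => (p.1 /\ x = val p.2) \/
      exists Cx : x \in ~` A, ~~ p.1 /\ p.2 = g (SigSub Cx))).
      move=> x; have [Ax|nAx] := pselect (A x).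
        by exists (true, SigSub (mem_set Ax)); left.
      exists (false, g (SigSub (mem_set (nAx : (~` A) x)))).
      by right; exists (mem_set (nAx : (~` A) x)).
    move=> x x' [[] y] /=.
      by move=> [[_ ->]|[? []//]] [[_ ->]|[? []//]].
    move=> [[]//|[Cx [_ ->]]] [[]//|[Cx' [_ /g_inj]]].
    by move/(congr1 val).
  exact: cle_trans (cle_prod kA kA) (cle_trans AA (cle_setTr A)).
pose C := range (fun a => val (h a)); pose A' := A `|` C.
have CnA x : C x -> ~ A x by move=> [a _ <-]; exact: set_mem (valP (h a)).
have A'A : cle A' A.
  apply: cle_trans boolA; apply: (@cle_rel_setl _ _ _
    (fun x (p : bool * A) => x = if p.1 then val p.2 else val (h p.2))).
    move=> x [Ax|[a _ <-]]; last by exists (false, a).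
    by exists (true, SigSub (mem_set Ax)).
  by move=> x x' p _ _ -> ->.
have /cleP[g g_inj] : cle (A' * A') A := cle_trans (cle_prod A'A A'A) AA.
(* [H'] sends the new pairs into [C], through [g] and then [h]; as [C] misses [A], no value of [G]
   is repeated. *)
pose H' : set (k * k * k) := [set w | exists p : A' * A',
  [/\ ~ (A (val p.1) /\ A (val p.2)), w.1 = (val p.1, val p.2)
    & w.2 = val (h (g p))]].
have H'C p z : H' (p, z) -> C z.
  by case=> q [_ _ /= ->]; exists (g q).
have GA x y z : G (x, y, z) -> [/\ A x, A y & A z].
  by case: HP => _ _ _; exact.
have H'nA x y z : H' (x, y, z) -> ~ (A x /\ A y).
  by case=> q [nA /= [-> ->]].
have [a0] : exists a : A, True by have /cleP[f _] := natA; exists (f 0%N).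
have Ca0 : A' (val (h a0)) by right; exists a0.
set s0 := SigSub (mem_set Ca0) : A'.
have H's0 : H' (val (h a0), val (h a0), val (h (g (s0, s0)))).
  by exists (s0, s0); split => //= -[Aa _]; apply: (CnA _ _ Aa); exists a0.
exfalso; apply: (Hmax (H `|` H')).
  split; first by left.
  move=> /(_ _ (or_intror H's0)) Hs0; have [Aa _ _] := GA _ _ _ (or_intror Hs0).
  by apply: (CnA _ _ Aa); exists a0.
suff : square_graph (G `|` H') by rewrite /G -setUA.
clearbody G.
have fld x : field (G `|` H') x <-> A' x.
  split=> [[z [/GA[] |[q [_ /= [-> _] _]]]]|A'x].
  - by left.
  - exact: set_mem (valP q.1).
  have [[z Gz]|nAx] := pselect (A x); first by exists z; left.
  exists (val (h (g (SigSub (mem_set A'x), SigSub (mem_set A'x))))); right.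
  by exists (SigSub (mem_set A'x), SigSub (mem_set A'x)); split => //= -[].
have [Gf Gi Gt Gc] := HP; split.
- move=> [x y] z z' [Gz|Hz] [Gz'|Hz'].
  + exact: Gf Gz Gz'.
  + by have [? ? _] := GA _ _ _ Gz; have [] := H'nA _ _ _ Hz'.
  + by have [? ? _] := GA _ _ _ Gz'; have [] := H'nA _ _ _ Hz.
  + case: Hz Hz' => -[q1 q2] [_ /= [-> ->] ->] [[q1' q2'] [_ /=]].
    by move=> [/val_inj-> /val_inj->].
- move=> [x y] [x' y'] z [Gz|Hz] [Gz'|Hz'].
  + exact: Gi Gz Gz'.
  + by have [_ _ ?] := GA _ _ _ Gz; have /CnA[] := H'C _ _ Hz'.
  + by have [_ _ ?] := GA _ _ _ Gz'; have /CnA[] := H'C _ _ Hz.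
  + case: Hz Hz' => -[q1 q2] [_ /= [-> ->] ->] [[q1' q2'] [_ /= [-> ->]]].
    by move=> /val_inj/h_inj/g_inj[-> ->].
- move=> x y /fld A'x /fld A'y; have [[Ax Ay]|nA] := pselect (A x /\ A y).
    by have [z Gz] := Gt x y Ax Ay; exists z; left.
  exists (val (h (g (SigSub (mem_set A'x), SigSub (mem_set A'y))))); right.
  by exists (SigSub (mem_set A'x), SigSub (mem_set A'y)).
- move=> x y z [/GA[Ax Ay Az]|Hz].
    by split; apply/fld; left.
  split; [| |by apply/fld; right; exact: H'C Hz];
    case: Hz => -[q1 q2] [_ /= [xE yE] _]; rewrite ?xE ?yE;
    apply/fld; exact: set_mem (valP _).
Qed.

End square.

Lemma cle_mul (k a b : Type) : cle nat k -> cle a k -> cle b k -> cle (a * b) k.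
Proof.
by move=> natk ak bk; exact: cle_trans (cle_prod ak bk) (cle_square natk).
Qed.

Lemma cle_add (k a b : Type) : cle nat k -> cle a k -> cle b k -> cle (a + b) k.
Proof.
move=> natk ak bk; apply: cle_trans (cle_sum ak bk) _.
apply: cle_trans (cle_mul natk (cle_trans (cle_count bool) natk) (cle_refl k)).
apply/cleP; exists (fun x => match x with inl y => (true, y) | inr y => (false, y) end).
by move=> [x|x] [y|y] // [->].
Qed.

(** Either some row of the square goes entirely into [b], or every row has a point sent into [a];
    points of different rows have different images. *)
Lemma cle_sum_split (m a b : Type) : cle (m * m) (a + b) -> cle m a \/ cle m b.
Proof.
move=> /cleP[f f_inj].
have [[x xP]|nx] := pselect (exists x, forall y, exists u, f (x, y) = inr u).
  right; apply: (@cle_rel _ _ (fun y u => f (x, y) = inr u)) => // y y' u <-.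
  by move=> /f_inj[].
left; apply: (@cle_rel _ _ (fun x u => exists y, f (x, y) = inl u)).
  move=> x; apply: contrapT => nu; apply: nx; exists x => y.
  by case E: (f (x, y)) => [u|u]; [case: nu; exists u, y|exists u].
by move=> x x' u [y fxy] [y']; rewrite -fxy => /f_inj[].
Qed.

Lemma clt_nat_add (l a : Type) : clt nat l -> clt a l -> clt (nat + a) l.
Proof.
move=> natl al; have [na|an] := cle_total nat a.
  by apply: cle_clt_trans al; apply: cle_add => //; exact: cle_refl.
by apply: cle_clt_trans natl; apply: cle_add => //; exact: cle_refl.
Qed.

Lemma clt_nat_finite (T : Type) : clt T nat <-> finite_set [set: T].
Proof.
have natT : ([set: nat] #<= [set: T])%card = cle nat T by [].
split=> [/cltP|fT]; last by apply/cltP; rewrite -natT => /infiniteP.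
by move=> nn; apply: contrapT => /infiniteP; rewrite natT.
Qed.

Lemma finite_cle_ord (T : Type) : finite_set [set: T] -> exists n, cle T 'I_n.
Proof.
move=> /finite_setP[n]; rewrite card_eq_le => /andP[+ _].
move=> /card_leP/injfunPex[f _ f_inj]; exists n.
apply: (@cle_rel _ _ (fun x (i : 'I_n) => val (f (to_setT x)) = val i)).
  by move=> x; exists (Ordinal (set_mem (valP (f (to_setT x))))).
move=> x y i fx fy; have : f (to_setT x) = f (to_setT y).
  by apply: val_inj; rewrite fx fy.
by move/(f_inj _ _ (in_setT _) (in_setT _))/(congr1 val).
Qed.

Lemma finite_cle_fun (m : Type) : clt m nat -> cle (m -> int) nat.
Proof.
move/clt_nat_finite/finite_cle_ord => [n mn].
apply: (@cle_trans ('I_n -> int)); first exact: cle_fun (inhabits 0) mn (cle_refl _).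
apply: cle_trans (cle_count {ffun 'I_n -> int}).
apply/cleP; exists finfun => u v /ffunP uv; apply/funext => i.
by have := uv i; rewrite !ffunE.
Qed.

(** * The powers 2^{<l} *)

Section cpowlt.
Variable l : Type.

Lemma cpowlt_ub (m : Type) : clt m l -> cle (m -> bool) (cpowlt bool l).
Proof.
move=> ml; have [|H _] := @csupP (fun c => exists2 m, clt m l & c = (m -> bool)).
  exists (l -> bool) => _ [m' m'l ->].
  exact: cle_fun (inhabits true) (clt_cle m'l) (cle_refl _).
by apply: H; exists m.
Qed.

Lemma cpowlt_le (u : Type) : (forall m, clt m l -> cle (m -> bool) u) ->
  cle (cpowlt bool l) u.
Proof.
move=> H; have [|_] := @csupP (fun c => exists2 m, clt m l & c = (m -> bool)).
  by exists u => _ [m ml ->]; exact: H.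
by apply => _ [m ml ->]; exact: H.
Qed.

Hypothesis natl : cle nat l.

(** A finite value c of 2^{<l} would be smaller than [l], so that 2^c would be at most c, against
    Cantor's theorem. *)
Lemma cle_nat_cpowlt : cle nat (cpowlt bool l).
Proof.
apply: contrapT => /cleNge cn.
have /cltP := cantor (cpowlt bool l); apply.
by apply: cpowlt_ub; exact: clt_cle_trans cn natl.
Qed.

(** An integer-valued function on an infinite [m] is coded by its graph, a subset of [m * nat]; on a
    finite [m] there are only countably many. *)
Lemma cle_int_cpowlt (m : Type) : clt m l -> cle (m -> int) (cpowlt bool l).
Proof.
move=> ml; have [natm|/cleNge] := pselect (cle nat m).
  apply: (cle_trans _ (cpowlt_ub ml)).
  apply: (@cle_trans (m * nat -> bool)).
    apply/cleP; exists (fun u p => pickle (u p.1) == p.2) => u v uv.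
    apply/funext => x; apply/esym/(pcan_inj pickleK)/eqP.
    by have /= <- := congr1 (@^~ (x, pickle (u x))) uv.
  exact: cle_fun (inhabits true) (cle_mul natm (cle_refl _) natm) (cle_refl _).
by move=> /finite_cle_fun/cle_trans; apply; exact: cle_nat_cpowlt.
Qed.

End cpowlt.

Lemma cpowlt_mono (l l' : Type) : cle l l' -> cle (cpowlt bool l) (cpowlt bool l').
Proof.
move=> ll'; apply: cpowlt_le => m ml; apply: cpowlt_ub.
exact: clt_cle_trans ml ll'.
Qed.

Lemma csup_family_ub (I : Type) (D : I -> Prop) (F : I -> Type) i :
  D i -> cle (F i) (csup (fun k => exists2 i, D i & k = F i)).
Proof.
move=> Di; have [|H _] := @csupP (fun k => exists2 i, D i & k = F i).
  (* The disjoint union of the family is an upper bound, as [csupP] requires. *)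
  exists {i & F i} => _ [j _ ->].
  apply/cleP; exists (existT _ j) => x y.
  pose cast (s : {i & F i}) := if pselect (projT1 s = j) is left e
    then Some (eq_rect _ F (projT2 s) _ e) else None.
  move=> /(congr1 cast); rewrite /cast; case: pselect => //= e.
  by rewrite (Prop_irrelevance e erefl) => -[].
by apply: H; exists i.
Qed.

(** If no [F i] exceeds [m], then [m] bounds the family and hence its supremum. *)
Lemma clt_csup_family (I : Type) (D : I -> Prop) (F : I -> Type) (m : Type) :
  clt m (csup (fun k => exists2 i, D i & k = F i)) -> exists2 i, D i & clt m (F i).
Proof.
move=> /cltP mF; apply: contrapT => nF; apply: mF.
have [|_] := @csupP (fun k => exists2 i, D i & k = F i).
  exists m => _ [i Di ->]; apply: contrapT => /cleNge Fm.
  by apply: nF; exists i.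
apply => _ [i Di ->]; apply: contrapT => /cleNge Fm.
by apply: nF; exists i.
Qed.

(** * Ball covers, nets and dense sets *)

Section metric.
Context {R : realType} {X : metricType R}.
Implicit Types (S E F M Q : set X) (l : Type).

Lemma nbhs_mdist (x : X) (A : set X) :
  nbhs x A <-> exists2 r : R, 0 < r & forall y, mdist x y < r -> A y.
Proof. by rewrite -metricType_numDomainType.filter_from_mdist_nbhs. Qed.

Lemma continuous_mdist (f : X -> R) : continuous f <-> forall y (e : R), 0 < e ->
  exists2 r : R, 0 < r & forall z, mdist y z < r -> `|f y - f z| < e.
Proof.
split=> [cf y e e0|cf y].
  by apply/nbhs_mdist; have /cvg_ballP/(_ e e0) := cf y.
by apply/cvg_ballP => e e0; apply/nbhs_mdist; exact: cf.
Qed.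

Lemma natSinv_lt (r : R) : 0 < r -> exists n, forall m, (n <= m)%N -> m.+1%:R^-1 < r.
Proof.
move=> r0; exists (Num.bound r^-1) => m nm.
rewrite invf_plt ?posrE//; apply: lt_le_trans (archi_boundP _) _.
  by rewrite invr_ge0 ltW.
by rewrite ler_nat (leq_trans nm).
Qed.

(* For [E `<=` S] and [S] closed: [E] is closed and discrete. *)
Definition no_accumulation E S := forall y, S y ->
  exists2 r : R, 0 < r & forall x, E x -> mdist y x < r -> x = y.

Definition dense_in Q F :=
  forall y (r : R), F y -> 0 < r -> exists2 q, Q q & mdist q y < r.

(* The only open covers of [S] to be thinned out consist of one ball around each
point. *)
Definition ball_lindelof S l := forall r : X -> R, (forall x, 0 < r x) ->
  exists A, [/\ A `<=` S, clt A l &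
    forall y, S y -> exists2 x, A x & mdist x y < r x].

Lemma ball_lindelof_le S l l' : cle l l' -> ball_lindelof S l -> ball_lindelof S l'.
Proof.
move=> ll' Sl r /Sl[A [AS Al Ar]]; exists A; split=> //.
exact: clt_cle_trans Al ll'.
Qed.

(** Around each point of [S] take a ball whose only possible point of [E] is its centre. A point of
    [E] covered by such a ball is its centre, so [E] lies in the small set [A]. *)
Lemma ball_lindelof_no_accumulation S E l :
  ball_lindelof S l -> E `<=` S -> no_accumulation E S -> clt E l.
Proof.
move=> Sl ES Eacc.
have [|r rP] := @choice _ _ (fun y (r : R) => 0 < r /\
    (S y -> forall x, E x -> mdist y x < r -> x = y)).
  move=> y; have [/Eacc[r r0 rE]|nS] := pselect (S y); first by exists r.
  by exists 1.
have [|A [AS Al Ar]] := Sl r; first by move=> x; case: (rP x).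
apply: cle_clt_trans Al; apply: cle_subset => e Ee.
have [x Ax xe] := Ar _ (ES _ Ee).
by have [_ /(_ (AS _ Ax) _ Ee xe) ->] := rP x.
Qed.

Lemma no_accumulationU E E' S :
  no_accumulation E S -> no_accumulation E' S -> no_accumulation (E `|` E') S.
Proof.
move=> HE HE' y Sy; have [r r0 rE] := HE _ Sy; have [r' r'0 rE'] := HE' _ Sy.
exists (Num.min r r'); first by rewrite lt_min r0.
by move=> x [Ex|E'x]; rewrite lt_min => /andP[? ?]; [exact: rE|exact: rE'].
Qed.

(** The ball of radius [r / 2] around [y] contains at most one point of [M]; if that point is not
    [y], its distance to [y] serves as radius. *)
Lemma separated_no_accumulation M S (r : R) : 0 < r ->
  (forall x y, M x -> M y -> mdist x y < r -> x = y) -> no_accumulation M S.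
Proof.
move=> r0 sepM y _.
have [[e [Me ye yer]]|ne] :=
  pselect (exists e, [/\ M e, y != e & mdist y e < r / 2]).
  exists (mdist y e) => [|x Mx yx]; first by rewrite mdist_gt0.
  have xe : x = e.
    apply: sepM => //; apply: le_lt_trans (metric_triangle _ y _) _.
    by rewrite [r]splitr ltrD// metric_sym (lt_trans yx).
  by move: yx; rewrite xe ltxx.
exists (r / 2) => [|x Mx yx]; first by rewrite divr_gt0.
apply/eqP; apply: contrapT => /negP xy; apply: ne.
by exists x; split => //; rewrite eq_sym.
Qed.

Lemma maximal_separated F (r : R) : 0 < r -> exists M, [/\ M `<=` F,
  forall x y, M x -> M y -> mdist x y < r -> x = y &
  forall y, F y -> exists2 x, M x & mdist x y < r].
Proof.
move=> r0; pose P := [set M | M `<=` F /\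
  forall x y, M x -> M y -> mdist x y < r -> x = y].
have [G GP Gtot|M [[MF sepM] Mmax]] := @Zorn_bigcup _ P.
  split=> [x [M /GP[MF _] /MF//]|x y [M GM Mx] [M' GM' M'y]].
  have [MM'|M'M] := Gtot _ _ GM GM'.
    by have [_] := GP _ GM'; apply => //; exact: MM'.
  by have [_] := GP _ GM; apply => //; exact: M'M.
exists M; split=> // y Fy; apply: contrapT => ny.
apply: (Mmax (M `|` [set y])).
  split=> [x|/(_ y (or_intror erefl)) My]; first by left.
  by apply: ny; exists y => //; rewrite mdistxx.
split=> [x [/MF//|->//]|x z].
move=> [Mx|->] [Mz|->] //; first exact: sepM.
- by move=> xy; case: ny; exists x.
- by rewrite metric_sym => xy; case: ny; exists z.
Qed.

(** The nets need not lie in [F]: each of their points is replaced by a point of [F] within the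
    mesh, if there is one, which at most doubles the mesh. *)
Lemma dense_in_of_nets F (T : nat -> set X) (k : Type) :
  (forall n, cle (T n) k) ->
  (forall n y, F y -> exists2 t, T n t & mdist t y < n.+1%:R^-1) ->
  exists Q, [/\ Q `<=` F, cle Q (nat * k) & dense_in Q F].
Proof.
move=> Tk Tnet.
have [|q qP] := @choice _ _ (fun (p : nat * X) (q : option X) =>
    if q is Some y then F y /\ mdist p.2 y < p.1.+1%:R^-1
    else forall y, F y -> ~ mdist p.2 y < p.1.+1%:R^-1).
  move=> p; have [[y py]|np] :=
    pselect (exists y, F y /\ mdist p.2 y < p.1.+1%:R^-1); first by exists (Some y).
  by exists None => y Fy py; apply: np; exists y.
exists [set y | exists n, exists2 t, T n t & q (n, t) = Some y]; split.
- by move=> y [n [t _ qy]]; have := qP (n, t); rewrite qy => -[].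
- have /all_sig[g g_inj] : forall n, {g : T n -> k | injective g}.
    by move=> n; apply: cid; apply/cleP.
  apply: (@cle_rel_setl _ _ _ (fun y (p : nat * k) => exists t : T p.1,
    q (p.1, val t) = Some y /\ g p.1 t = p.2)).
    move=> y [n [t Tt qy]].
    by exists (n, g n (SigSub (mem_set Tt))), (SigSub (mem_set Tt)).
  move=> y y' [n u] _ _ /= [t [qt <-]] [t' [qt' /g_inj tt']].
  by move: qt'; rewrite tt' qt => -[].
- move=> y r Fy r0; have [|n /(_ n (leqnn n)) nr] := @natSinv_lt (r / 2).
    by rewrite divr_gt0.
  have [t Tt ty] := Tnet n y Fy.
  have := qP (n, t); case qE: (q (n, t)) => [z|] /=; last by move/(_ _ Fy).
  move=> [Fz tz]; exists z; first by exists n, t.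
  apply: le_lt_trans (metric_triangle _ t _) _.
  by rewrite [r]splitr ltrD// ?(lt_trans _ nr)// metric_sym.
Qed.

(** Near [y] only the finitely many [E n] with [n < N] matter. *)
Lemma no_accumulation_locally_finite (E : nat -> set X) S :
  (forall n, no_accumulation (E n) S) ->
  (forall y, S y -> exists r : R, exists2 N, 0 < r &
     forall n x, (N <= n)%N -> E n x -> ~ mdist y x < r) ->
  no_accumulation (\bigcup_n E n) S.
Proof.
move=> Eacc Elf y Sy; have [r [N r0 rN]] := Elf y Sy.
have /(_ y Sy)[r' r'0 r'N] : no_accumulation (\bigcup_(n in `I_N) E n) S.
  elim: N {rN} => [|N IH]; first by move=> z _; exists 1 => // x [].
  by rewrite bigcup_mkord big_ord_recr/= -bigcup_mkord; exact: no_accumulationU.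
exists (Num.min r r'); first by rewrite lt_min r0.
move=> x [n _ Enx]; rewrite lt_min => /andP[yr yr'].
have [nN|Nn] := ltnP n N; first by apply: r'N => //; exists n.
by have := rN _ _ Nn Enx.
Qed.

Lemma clt_set0 (T : Type) l : cle nat l -> clt (@set0 T) l.
Proof.
move=> natl; apply/cltP => /(cle_trans natl)/cleP[f _].
exact: set_mem (valP (f 0%N)).
Qed.

(* If [l] is uncountable and no [F n] is small, each [F n] contains a closed discrete
[E n] larger than a fixed net of mesh [1 / n.+1] of [S].  The union of the [E n] is
again closed and discrete, hence smaller than [l], but it bounds all the nets at once,
and then [S] has a dense subset that is smaller than [l].  No assumption on the
cofinality of [l] is needed. *)
Lemma small_dense S (F : nat -> set X) l : cle nat l -> ball_lindelof S l ->
  (forall n, F n `<=` S) ->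
  (forall y, S y -> exists r : R, exists2 N, 0 < r &
     forall n x, (N <= n)%N -> F n x -> ~ mdist y x < r) ->
  exists n Q, [/\ Q `<=` F n, clt Q l & dense_in Q (F n)].
Proof.
(* If [l] is countable, the subcover is finite, and [F n] is empty for [n] the largest index
   attached to its centres. *)
move=> natl Sl FS Flf; have [ln|/cleNge nl] := pselect (cle l nat).
  have [|r rP] := @choice _ _ (fun y (p : R * nat) => 0 < p.1 /\
    (S y -> forall n x, (p.2 <= n)%N -> F n x -> ~ mdist y x < p.1)).
    move=> y; have [Sy|nS] := pselect (S y); last by exists (1, 0%N).
    by have [r [N r0 rN]] := Flf _ Sy; exists (r, N).
  have [|A [AS Al Ar]] := Sl (fst \o r); first by move=> x; case: (rP x).
  have /clt_nat_finite/finite_cle_ord[k /cleP[g g_inj]] := clt_cle_trans Al ln.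
  have [|h hP] := @choice _ _ (fun (i : 'I_k) m => forall x : A,
      g x = i -> ((r (val x)).2 <= m)%N).
    move=> i; have [[x xi]|nx] := pselect (exists x, g x = i).
      by exists (r (val x)).2 => y; rewrite -xi => /g_inj ->.
    by exists 0%N => x xi; case: nx; exists x.
  exists (\max_i h i)%N, set0; split => //; first exact: clt_set0.
  move=> y e Fy _; have [x Ax xy] := Ar _ (FS _ _ Fy).
  have [_ /(_ (AS _ Ax))] := rP x => /(_ _ _ _ Fy xy) [].
  apply: leq_trans (hP _ (SigSub (mem_set Ax)) erefl) _.
  exact: leq_bigmax.
apply: contrapT => nQ.
have {}nQ n Q : Q `<=` F n -> dense_in Q (F n) -> ~ clt Q l.
  by move=> QF Qd Ql; apply: nQ; exists n, Q.
have [|T TP] := @choice _ _ (fun n (T : set X) => clt T l /\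
    forall y, S y -> exists2 t, T t & mdist t y < n.+1%:R^-1).
  move=> n; have [|T [_ Tl Tn]] := Sl (fun _ => n.+1%:R^-1).
    by move=> _; rewrite invr_gt0.
  by exists T.
have [|E EP] := @choice _ _ (fun n (E : set X) => [/\ E `<=` F n, no_accumulation E S &
    ~ cle E (nat + T n)]).
  (* Otherwise the maximal separated subsets of [F n] of all meshes are no larger than [nat + T n],
     and they yield a small dense subset of [F n]. *)
  move=> n; apply: contrapT => nE.
  have [|M MP] := @choice _ _ (fun m (M : set X) => [/\ M `<=` F n, cle M (nat + T n) &
      forall y, F n y -> exists2 x, M x & mdist x y < m.+1%:R^-1]).
    move=> m; have m0 : 0 < m.+1%:R^-1 :> R by rewrite invr_gt0.
    have [M [MF sepM Mn]] := maximal_separated (F n) m0.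
    exists M; split => //; apply: contrapT => nM; apply: nE; exists M; split => //.
    exact: separated_no_accumulation sepM.
  have [||Q [QF Qc Qd]] := @dense_in_of_nets (F n) M (nat + T n).
  - by move=> m; have [] := MP m.
  - by move=> m; have [] := MP m.
  apply: nQ QF Qd _.
  apply: (@cle_clt_trans _ (nat + T n)); last by apply: clt_nat_add => //; case: (TP n).
  have natT := cle_inl nat (T n); apply: (cle_trans Qc).
  exact: (cle_mul natT natT (cle_refl _)).
set U := \bigcup_n E n.
have Ul : clt U l.
  apply: (ball_lindelof_no_accumulation Sl).
    by move=> x [n _ Ex]; apply: (FS n); have [+ _ _] := EP n; exact.
  apply: no_accumulation_locally_finite => [n|y Sy]; first by have [] := EP n.
  have [r [N r0 rN]] := Flf y Sy; exists r, N => // n x Nn Ex.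
  by apply: (rN n) => //; have [+ _ _] := EP n; exact.
have TU n : cle (T n) U.
  have [_ _ /cleNge/clt_cle] := EP n.
  move=> /(cle_trans (cle_inr nat (T n))) /cle_trans; apply.
  by apply: cle_subset => x Ex; exists n.
(* As [U] bounds every [T n], already [F 0] has a small dense subset, a contradiction. *)
have [|Q [QF Qc Qd]] := @dense_in_of_nets (F 0%N) T U TU.
  by move=> n y Fy; have [_] := TP n; apply; exact: FS Fy.
apply: nQ QF Qd _; apply: (cle_clt_trans _ (clt_nat_add nl Ul)).
have nU := cle_inl nat U; apply: (cle_trans Qc).
exact: (cle_mul nU nU (cle_inr _ _)).
Qed.

End metric.

(** * The upper bound *)

Lemma delta_cover (Y : topologicalType) (U : set (set Y)) :
  U `<=` open -> \bigcup_(A in U) A = setT ->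
  exists V : set (set Y),
    [/\ V `<=` U, \bigcup_(A in V) A = setT & clt V (delta Y)].
Proof.
rewrite /delta; set P := fun m : Type => _.
move=> Uo UT; have [|PP _] := @cminP P.
  (* The class has a member: by Cantor's theorem this cardinal exceeds every family of subsets of
     [Y]. *)
  exists (set Y -> bool) => W _ WT; exists W; split => //.
  exact: cle_clt_trans (cle_setTr W) (cantor _).
have [V [VU VT Vm]] := PP U Uo UT; exists V; split => //.
exact: clt_cle_trans Vm (cle_inr _ _).
Qed.

Section upper_bound.
Context {R : realType} {X : metricType R}.
Implicit Types (S B : set X) (l : Type).

Lemma open_mdist_ball (x : X) (r : R) : open [set y | mdist x y < r].
Proof.
rewrite openE => y /= xy; apply/nbhs_mdist.
exists (r - mdist x y); first by rewrite subr_gt0.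
move=> z; rewrite ltrBrDl; apply: le_lt_trans; exact: metric_triangle.
Qed.

Lemma delta_ball_lindelof S : ball_lindelof S (delta S).
Proof.
move=> r r0; pose O (x : S) := [set y : S | mdist (val x) (val y) < r (val x)].
have [||V [VU VT Vm]] := @delta_cover _ (range O).
- move=> _ [x _ <-]; apply: open_comp (open_mdist_ball (val x) (r (val x))).
  by move=> y _; exact: initial_continuous.
- rewrite -subTset => y _; exists (O y); first by exists y.
  by rewrite /O /= mdistxx.
have [|c cP] := @choice _ _ (fun v (o : option X) => V v ->
    exists2 x : S, o = Some (val x) & v = O x).
  move=> v; have [/VU[x _ xv]|nv] := pselect (V v); last by exists None.
  by exists (Some (val x)) => _; exists x.
exists [set x | exists2 v, V v & c v = Some x]; split.
- move=> x [v /cP[y -> _] [<-]]; exact: set_mem (valP y).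
- apply: cle_clt_trans Vm.
  apply: (@cle_rel_set _ _ _ _ (fun x v => c v = Some x)) => [x [v]|]; first by exists v.
  by move=> x x' v _ _ _ -> [].
- move=> y Sy; have : [set: S] (SigSub (mem_set Sy)) by [].
  rewrite -VT => -[v Vv]; have [x cx ->] := cP _ Vv; move=> xy.
  by exists (val x) => //; exists v.
Qed.

Lemma delta1s_shield B : exists S,
  [/\ closed S, shield S B & ball_lindelof S (delta1s B)].
Proof.
rewrite /delta1s; set P := fun m : Type => _.
have [|[S [cS sS PE]] _] := @cminP P.
  (* The class has a member, since the whole space is a shield for every set. *)
  exists (delta [set: X]), setT; split=> // C _.
  by rewrite setIT => ->; exists 1 => //; rewrite set0I.
exists S; split => //; rewrite PE.
apply: ball_lindelof_le (cle_inr _ _) (delta_ball_lindelof S).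
Qed.

Lemma floor_eq_dist (x y : R) : Num.floor x = Num.floor y -> `|x - y| < 1.
Proof.
move=> xy; have /andP[x1 x2] := floor_itv x; have /andP[y1 y2] := floor_itv y.
rewrite xy in x1 x2; rewrite intrD in x2 y2.
rewrite ltr_norml; apply/andP; split.
  by rewrite ltrBrDl -ltrBrDr opprK; apply: lt_le_trans y2 _; rewrite lerD2r.
by rewrite ltrBlDl; apply: lt_le_trans x2 _; rewrite lerD2r.
Qed.

(* Let [T n] be a net of mesh [1 / n.+1].  The balls around the points of [T n] on
which [f] varies by less than [e] leave out a set [F n] of points of [S], and these
sets form a locally finite family.  For a suitable [n], [f] is determined up to [3 e]
by the subset [good n f] of [T n] and the values of [f], rounded to multiples of [e],
on [T n] and on a small dense subset of [F n], chosen in advance as a function of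
[good n f]. *)
Lemma ball_lindelof_code S l (e : R) : 0 < e -> cle nat l -> ball_lindelof S l ->
  exists c : (X -> R) -> cpowlt bool l, forall f g, continuous f -> continuous g ->
    c f = c g -> forall y, S y -> `|f y - g y| < e *+ 3.
Proof.
move=> e0 natl Sl; pose P := cpowlt bool l.
have [|T TP] := @choice _ _ (fun n (T : set X) => [/\ T `<=` S, clt T l &
    forall y, S y -> exists2 t, T t & mdist t y < n.+1%:R^-1]).
  by move=> n; apply: Sl => _; rewrite invr_gt0.
pose good n (f : X -> R) (x : T n) : bool := `[< forall y z, S y -> S z ->
  mdist (val x) y < n.+1%:R^-1 -> mdist (val x) z < n.+1%:R^-1 ->
  `|f y - f z| < e >].
pose F n (G : T n -> bool) := [set y | S y /\
  forall x, G x -> ~ mdist (val x) y < n.+1%:R^-1].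
have QP n (G : T n -> bool) : exists Q : set X, clt Q l /\
    ((exists Q', [/\ Q' `<=` F n G, clt Q' l & dense_in Q' (F n G)]) ->
     dense_in Q (F n G)).
  have [[Q [_ Ql Qd]]|nQ] := pselect (exists Q', [/\ Q' `<=` F n G, clt Q' l &
    dense_in Q' (F n G)]); first by exists Q.
  by exists set0; split => //; exact: clt_set0.
pose Q n G := sval (cid (QP n G)).
have /all_sig[iG iG_inj] : forall n, {i : (T n -> bool) -> P | injective i}.
  by move=> n; apply/cid/cleP/cpowlt_ub; have [] := TP n.
have /all_sig[iT iT_inj] : forall n, {i : (T n -> int) -> P | injective i}.
  by move=> n; apply/cid/cleP/cle_int_cpowlt => //; have [] := TP n.
have iQP n G : exists i : (Q n G -> int) -> P, injective i.
  by apply/cleP/cle_int_cpowlt => //; rewrite /Q; case: cid => ? [].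
pose iQ n G := sval (cid (iQP n G)).
have iQ_inj n G : injective (iQ n G) by rewrite /iQ; case: cid.
have [|N NP] := @choice _ _ (fun f n => continuous f ->
    dense_in (Q n (good n f)) (F n (good n f))).
  move=> f; have [/continuous_mdist cf|nf] := pselect (continuous f); last by exists 0%N.
  have [||n [Q' Q'P]] := @small_dense _ _ S (fun n => F n (good n f)) l natl Sl.
  - by move=> n y [].
  - move=> y Sy; have [|r r0 fr] := cf y (e / 2); first by rewrite divr_gt0.
    (* A net ball of radius below [r / 4] that contains a point within [r / 2] of [y] lies within
       [r] of [y], where [f] stays within [e / 2] of [f y]; so that ball is good. *)
    have [|M MP] := @natSinv_lt _ (r / 2 / 2); first by rewrite !divr_gt0.
    exists (r / 2), M; first by rewrite divr_gt0.
    move=> n x Mn [Sx xG] yx; have [_ _ /(_ _ Sx)[t Tt tx]] := TP n.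
    apply: (xG (SigSub (mem_set Tt))) => //=.
    have tr z : mdist t z < n.+1%:R^-1 -> mdist y z < r.
      move=> tz; apply: le_lt_trans (metric_triangle _ x _) _.
      rewrite [r]splitr ltrD//; apply: le_lt_trans (metric_triangle _ t _) _.
      rewrite [r / 2]splitr ltrD// ?(lt_trans tz)// ?MP//.
      by rewrite metric_sym (lt_trans tx)// MP.
    apply/asboolP => z z' _ _ /= /tr/fr yz /tr/fr yz'.
    rewrite -(subrKA (f y)) (le_lt_trans (ler_normD _ _))// [e]splitr ltrD//.
    by rewrite distrC.
  exists n => _; rewrite /Q; case: cid => /= Q0 [_]; apply; exists Q'.
  exact: Q'P.
pose fl f (y : X) := Num.floor (f y / e) : int.
have flP f g y : fl f y = fl g y -> `|f y - g y| < e.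
  move=> /floor_eq_dist; rewrite -mulrBl normrM (gtr0_norm (_ : 0 < e^-1)) ?invr_gt0//.
  by rewrite ltr_pdivrMr// mul1r.
pose code f := (N f, (iG _ (good (N f) f), (iT (N f) (fl f \o val),
   iQ _ (good (N f) f) (fl f \o val)))).
have natP : cle nat P := cle_nat_cpowlt natl.
have /cleP[i i_inj] : cle (nat * (P * (P * P))) P.
  by apply: (cle_mul natP natP (cle_mul natP _ (cle_mul natP _ _))); exact: cle_refl.
exists (i \o code) => f g cf cg /= /i_inj.
rewrite /code => -[]; move: (NP f cf) (NP g cg) => Qf _ Nfg.
(* The components are compared in order, because the injections [iG], [iT] and [iQ] depend on the
   earlier ones. *)
rewrite -Nfg => /iG_inj Gfg; rewrite -Gfg => /iT_inj Tfg /iQ_inj Qfg y Sy.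
set n := N f in Qf Gfg Tfg Qfg.
suff [x [fx gx xfg]] : exists x,
    [/\ `|f y - f x| < e, `|g y - g x| < e & fl f x = fl g x].
  rewrite -(subrKA (f x)) (le_lt_trans (ler_normD _ _))// mulrSr addrC ltrD//.
  rewrite -(subrKA (g x)) (le_lt_trans (ler_normD _ _))// mulr2n ltrD//.
    exact: flP.
  by rewrite distrC.
(* The point sought is the centre of a good ball around [y] or, when there is none, a point of the
   dense subset of [F n] close to [y]. *)
have [[x Gx xy]|nx] := pselect (exists2 x : T n, good n f x &
  mdist (val x) y < n.+1%:R^-1).
  exists (val x); have Sx : S (val x).
    by have [TS _ _] := TP n; apply: TS; exact: set_mem (valP x).
  have xx : mdist (val x) (val x) < n.+1%:R^-1 :> R by rewrite mdistxx invr_gt0.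
  split; first by have /asboolP := Gx; exact.
    by move: Gx; rewrite Gfg => /asboolP; exact.
  by have := congr1 (@^~ x) Tfg.
have Fy : F n (good n f) y by split=> // x Gx xy; apply: nx; exists x.
have /continuous_mdist/(_ y e e0)[r r0 fr] := cf.
have /continuous_mdist/(_ y e e0)[r' r'0 gr] := cg.
have [|q Qq qy] := Qf y (Num.min r r') Fy; first by rewrite lt_min r0.
move: qy; rewrite lt_min metric_sym => /andP[yq yq'].
exists q; split; [exact: fr|exact: gr|].
by have := congr1 (@^~ (SigSub (mem_set Qq))) Qfg.
Qed.

Variable BB : bornology X.
Implicit Types f g : CX_strong BB.

Lemma nbhs_strong f (A : set (CX_strong BB)) : nbhs f A <->
  exists B (e : R), [/\ bset BB B, 0 < e & forall g, strong_ent_of B e (f, g) -> A g].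
Proof.
rewrite -(@nbhs_entourageE (CX_strong BB)); split.
  move=> [E [[B e] /= [BB' e0] BeE] EA]; exists B, e; split => // g fg.
  by apply: EA; apply/xsectionP; exact: BeE.
move=> [B [e [BB' e0 fA]]]; exists (strong_ent_of B e); first by exists (B, e).
by move=> g /xsectionP/fA.
Qed.

End upper_bound.

(** * A small base of the topology *)

Section upper_bound_weight.
Context {R : realType} {X : metricType R} (BB : bornology X).
Implicit Types f g : CX_strong BB.

Lemma strong_ent_trans B (e : R) f g h : 0 < e ->
  strong_ent_of B e (f, h) -> strong_ent_of B e (h, g) ->
  strong_ent_of B (e *+ 2) (f, g).
Proof.
move=> e0 [d d0 fh] [d' d'0 hg]; exists (Num.min d d'); first by rewrite lt_min d0.
move=> x [b Bb]; rewrite lt_min => /andP[xd xd'] /=.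
rewrite -(subrKA ((h : continuousType X R) x)) mulr2n.
by apply: le_lt_trans (ler_normD _ _) (ltrD _ _); [apply: fh|apply: hg]; exists b.
Qed.

(** The points where two functions with equal codes differ by at least [e] form a closed set that
    misses the shield [S], hence also some enlargement of [closure B]. *)
Lemma strong_ent_code (B : set X) (e : R) : bset BB B -> 0 < e ->
  exists c : CX_strong BB -> cpowlt bool (delta1s_sup BB),
    forall f g, c f = c g -> strong_ent_of B e (f, g).
Proof.
move=> BBB e0; have [S [cS sS lS]] := delta1s_shield (closure B).
have e30 : 0 < e / 3 by rewrite divr_gt0.
have [c cP] := ball_lindelof_code e30 (cle_inl _ _) lS.
have /cleP[i i_inj] : cle (cpowlt bool (delta1s (closure B)))
    (cpowlt bool (delta1s_sup BB)).
  by apply: cpowlt_mono; exact: (@csup_family_ub _ _ (fun B => delta1s (closure B))).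
exists (fun f => i (c (f : continuousType X R))) => f g /i_inj cfg.
pose u := (f : continuousType X R) : X -> R.
pose v := (g : continuousType X R) : X -> R.
have cu : continuous u := @cts_fun _ _ (f : continuousType X R).
have cv : continuous v := @cts_fun _ _ (g : continuousType X R).
have uv y : S y -> `|u y - v y| < e.
  move=> Sy; have := cP u v cu cv cfg y Sy.
  by rewrite -[_ *+ 3]mulr_natr divfK ?pnatr_eq0.
have [||d d0 Cd] := sS [set x | e <= `|u x - v x|].
- rewrite -openC; rewrite openE => y /= /negP; rewrite -ltNge => yuv.
  pose s := (e - `|u y - v y|) / 2.
  have s0 : 0 < s by rewrite divr_gt0// subr_gt0.
  have /continuous_mdist/(_ y s s0)[r r0 ur] := cu.
  have /continuous_mdist/(_ y s s0)[r' r'0 vr] := cv.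
  apply/nbhs_mdist; exists (Num.min r r'); first by rewrite lt_min r0.
  move=> z; rewrite lt_min => /andP[/ur yzu /vr yzv]; apply/negP; rewrite -ltNge.
  have -> : u z - v z = (u y - v y) + ((v y - v z) - (u y - u z)).
    by rewrite !opprB; ring.
  rewrite (le_lt_trans (ler_normD _ _))// -ltrBrDl.
  by rewrite (le_lt_trans (ler_normB _ _))// [ltRHS]splitr ltrD.
- by rewrite -subset0 => x [/= + Sx]; rewrite leNgt uv.
exists d => // x [b Bb bx] /=; rewrite ltNge; apply/negP => exx.
have : ([set x | e <= `|u x - v x|] `&` enlargement (closure B) d) x.
  by split => //; exists b => //; exact: subset_closure.
by rewrite Cd.
Qed.

Lemma weight_le_basis (T : topologicalType) (U : set (set T)) (k : Type) :
  cle nat k -> basis U -> cle U k -> cle (weight T) k.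
Proof.
move=> natk bU Uk; apply: cle_add => //; apply: cle_trans Uk.
have [|_] := @cminP (fun k => exists2 U : set (set T), basis U & k = U).
  by exists U, U.
by apply; exists U.
Qed.

Lemma weight_strong_le :
  cle (weight (CX_strong BB)) (cf BB * cpowlt bool (delta1s_sup BB)).
Proof.
have natP : cle nat (cpowlt bool (delta1s_sup BB)).
  apply: cle_nat_cpowlt.
  apply: cle_trans (@csup_family_ub _ _ (fun B => delta1s (closure B)) _
    (bornology_set0 BB)).
  exact: cle_inl.
have natcf : cle nat (cf BB) by exact: cle_inl.
have natK : cle nat (cf BB * cpowlt bool (delta1s_sup BB)).
  apply: cle_trans (cle_prod natcf natP).
  by apply/cleP; exists (fun n => (n, n)) => ? ? [].
have [|[B0 [B0B B0b] B0E] _] :=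
    @cminP (fun k => exists2 B0, bornology_base BB B0 & k = B0).
  by exists (bset BB), (bset BB) => //; split => // A; exists A.
have [|c cP] := @choice _ _ (fun p : set X * nat =>
    fun c : CX_strong BB -> cpowlt bool (delta1s_sup BB) => bset BB p.1 ->
    forall f g, c f = c g -> strong_ent_of p.1 p.2.+1%:R^-1 (f, g)).
  move=> [B n] /=; have [BBB|nB] := pselect (bset BB B); last first.
    by have /cleP[i _] := natP; exists (fun=> i 0%N).
  have [|c cP] := @strong_ent_code B n.+1%:R^-1 BBB; first by rewrite invr_gt0.
  by exists c.
(* No centre is chosen in the class of code [p]: all its members serve at once. They are close to
   each other, so passing from one to another only doubles the error. *)
pose V B n p : set (CX_strong BB) := [set g | exists2 f, c (B, n) f = p &
  strong_ent_of B n.+1%:R^-1 (f, g)]^°.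
pose U := [set W | exists B n p, B0 B /\ W = V B n p].
apply: (@weight_le_basis _ U) => //.
  split=> [_ [B [n [p [_ ->]]]]|f A /nbhs_strong[B [e [BBB e0 BeA]]]].
    exact: open_interior.
  have [B' B0B' BB'] := B0b _ BBB.
  have [|n /(_ n (leqnn n)) ne] := @natSinv_lt _ (e / 2); first by rewrite divr_gt0.
  have n0 : 0 < n.+1%:R^-1 :> R by rewrite invr_gt0.
  exists (V B' n (c (B', n) f)).
    split; first by exists B', n, (c (B', n) f).
    apply/nbhs_strong; exists B', n.+1%:R^-1; split => //; first exact: B0B.
    by move=> g fg; exists f.
  move=> g /interior_subset[h cfh hg]; apply: BeA.
  have fh := cP (B', n) (B0B _ B0B') _ _ (esym cfh).
  have [d d0 fg] := strong_ent_trans n0 fh hg; exists d => // x [b Bb bx].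
  apply: lt_trans (fg x _) _; first by exists b => //; exact: BB'.
  by rewrite -[_ *+ 2]mulr_natr -ltr_pdivlMr.
apply: (@cle_trans (B0 * (nat * cpowlt bool (delta1s_sup BB)))).
  apply: (@cle_rel_setl _ _ _ (fun W p => W = V (val p.1) p.2.1 p.2.2)).
    by move=> _ [B [n [p [B0B' ->]]]]; exists (SigSub (mem_set B0B'), (n, p)).
  by move=> W W' p _ _ -> ->.
apply: cle_prod; first by rewrite -B0E; exact: cle_inr.
by apply: cle_mul => //; exact: cle_refl.
Qed.

End upper_bound_weight.

(** * Extension from closed discrete sets *)

Section tent.
Context {R : realType} {X : metricType R}.
Implicit Types (x y z : X) (r c e : R).

Definition tent x r c z : R := c * Num.max 0 (1 - mdist x z / r).

Lemma tent_center x r c : tent x r c x = c.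
Proof. by rewrite /tent mdistxx mul0r subr0 max_r ?mulr1. Qed.

Lemma tent_out x r c z : 0 < r -> r <= mdist x z -> tent x r c z = 0.
Proof.
by move=> r0 rxz; rewrite /tent max_l ?mulr0// subr_le0 ler_pdivlMr// mul1r.
Qed.

Lemma mdist_lipschitz x y z : `|mdist x y - mdist x z| <= mdist y z.
Proof.
have := metric_triangle x z y; have := metric_triangle x y z.
by rewrite (metric_sym z y) => xyz xzy; rewrite ler_norml; apply/andP; split; lra.
Qed.

Lemma max0_lipschitz (a b : R) : `|Num.max 0 a - Num.max 0 b| <= `|a - b|.
Proof.
have H u v : Num.max 0 u - Num.max 0 v <= `|u - v| :> R.
  have := ler_norm (u - v); have := normr_ge0 (u - v).
  by case: (lerP 0 u) => ?; case: (lerP 0 v) => ? ? ?; lra.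
by rewrite ler_norml H andbT lerNl opprB distrC H.
Qed.

Lemma tent_continuous x r c : 0 < r -> continuous (tent x r c).
Proof.
move=> r0; apply/continuous_mdist => y e e0.
(* A Lipschitz constant of the tent; adding 1 keeps it positive when [c] is 0. *)
have K0 : 0 < (`|c| + 1) / r by rewrite divr_gt0// ltr_wpDl.
exists (e / ((`|c| + 1) / r)) => [|z]; first by rewrite divr_gt0.
rewrite ltr_pdivlMr// => yz; rewrite -mulrBr normrM.
apply: le_lt_trans yz; rewrite [leRHS]mulrC -mulrA ler_pM// ?lerDl//.
apply: le_trans (max0_lipschitz _ _) _.
rewrite opprB addrC subrKA -mulrBl normrM (gtr0_norm (_ : 0 < r^-1)) ?invr_gt0//.
by rewrite [leLHS]mulrC distrC ler_wpM2l ?mdist_lipschitz// invr_ge0 ltW.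
Qed.

Lemma closed_discrete_no_accumulation (D : set X) :
  closed_discrete D -> no_accumulation D [set: X].
Proof.
move=> [Dc Di] y _; have [Dy|nDy] := pselect (D y).
  have [_ [V /nbhs_mdist[r r0 rV] VD]] := Di _ Dy.
  exists r => // x Dx /rV Vx.
  by have : (V `&` D) x by []; rewrite VD.
have : (~` D) y by [].
have : open (~` D) by rewrite openC.
rewrite openE => /[apply] /nbhs_mdist[r r0 rD].
by exists r => // x Dx /rD.
Qed.

(* Tents of radius a quarter of the isolation radii form a discrete family. *)
Lemma discrete_extension (D : set X) (v : X -> R) : no_accumulation D [set: X] ->
  exists2 f : X -> R, continuous f & forall x, D x -> f x = v x.
Proof.
move=> Dd.
have [|r rP] := @choice _ _ (fun (y : X) (s : R) => 0 < s /\
    forall x, D x -> mdist y x < s -> x = y).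
  by move=> y; have [//|s s0 sD] := Dd y; exists s.
have r0 y : 0 < r y by case: (rP y).
have rD y x : D x -> mdist y x < r y -> x = y by case: (rP y) => _; exact.
have rle x x' : D x -> D x' -> x != x' -> r x <= mdist x x'.
  by move=> Dx Dx'; apply: contraNle => /(rD _ _ Dx') ->.
pose near x z := D x /\ mdist x z < r x / 4.
(* The ball of radius [r y / 4] around [y] meets at most one tent: if it met two, their centres
   would both lie within [r y] of [y] and so equal [y]. *)
have near_eq y z z' x x' : mdist y z < r y / 4 -> mdist y z' < r y / 4 ->
    near x z -> near x' z' -> x = x'.
  move=> yz yz' [Dx xz] [Dx' xz']; apply/eqP; apply: contrapT => /negP xx'.
  have rx := rle _ _ Dx Dx' xx'.
  have rx' : r x' <= mdist x x' by rewrite metric_sym rle// eq_sym.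
  have ry := r0 y; have t1 := metric_triangle x z x'.
  have t2 := metric_triangle z y x'.
  have t3 := metric_triangle y z' x'.
  have t4 := metric_triangle y z x.
  rewrite (metric_sym z y) in t2; rewrite (metric_sym z' x') in t3.
  rewrite (metric_sym z x) in t4.
  have yx : x = y by apply: rD => //; lra.
  have yx' : x' = y by apply: rD => //; lra.
  by rewrite yx yx' eqxx in xx'.
have [|f fP] := @choice _ _ (fun (z : X) (a : R) =>
    (forall x, near x z -> a = tent x (r x / 4) (v x) z) /\
    ((forall x, ~ near x z) -> a = 0)).
  move=> z; have [[x xz]|nx] := pselect (exists x, near x z); last first.
    by exists 0; split => // x xz; case: nx; exists x.
  exists (tent x (r x / 4) (v x) z); split => [x' xz'|/(_ _ xz)//].
  by rewrite (near_eq z z z x x')// mdistxx divr_gt0.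
have r40 x : 0 < r x / 4 by rewrite divr_gt0.
exists f; last first.
  move=> x Dx; have [fx _] := fP x; rewrite (fx x) ?tent_center//.
  by split => //; rewrite mdistxx.
apply/continuous_mdist => y e e0.
(* Near [y] the function is a single tent or identically 0. *)
have [[x [z [yz xz]]]|nx] :=
  pselect (exists x z, mdist y z < r y / 4 /\ near x z).
  have /continuous_mdist/(_ y e e0)[s s0 sP] := @tent_continuous x _ (v x) (r40 x).
  have fE z' : mdist y z' < r y / 4 -> f z' = tent x (r x / 4) (v x) z'.
    move=> yz'; have [f1 f2] := fP z'.
    have [[x' xz']|nx'] := pselect (exists x', near x' z').
      by rewrite (near_eq y z z' x x')// -f1.
    rewrite f2; last by move=> x' xz'; apply: nx'; exists x'.
    rewrite tent_out// leNgt; apply/negP => xz'; apply: nx'; exists x.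
    by split => //; case: xz.
  exists (Num.min s (r y / 4)); first by rewrite lt_min s0 r40.
  move=> z'; rewrite lt_min => /andP[yz's yz'].
  by rewrite !fE ?mdistxx//; exact: sP.
exists (r y / 4) => // z yz.
have f0 z' : mdist y z' < r y / 4 -> f z' = 0.
  by move=> yz'; apply: (fP z').2 => x xz'; apply: nx; exists x, z'.
by rewrite !f0 ?mdistxx// subrr normr0.
Qed.

End tent.

(** * The lower bound *)

Section lower_bound.
Context {R : realType} {X : metricType R} (BB : bornology X).
Implicit Types f g : CX_strong BB.

Definition to_strong (f : X -> R) (cf : continuous f) : CX_strong BB :=
  (mkcts cf : continuousType X R).

Lemma weight_basis (T : topologicalType) :
  exists2 U : set (set T), basis U & cle U (weight T).
Proof.
have [|[U bU UE] _] := @cminP (fun k => exists2 U : set (set T), basis U & k = U).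
  exists [set A : set T | open A], [set A : set T | open A] => //.
  split=> [A //|x A]; rewrite nbhsE => -[B [Bo Bx] BA]; exists B => //.
exists U => //; rewrite /weight -UE; exact: cle_inr.
Qed.

Lemma bornology_closure (B : set X) :
  has_closed_base BB -> bset BB B -> bset BB (closure B).
Proof.
move=> [B0 [B0B B0b] B0c] /B0b[A B0A BA].
apply: (bornology_subset _ (B0B _ B0A)); rewrite closureE.
by apply: smallest_sub => //; exact: B0c.
Qed.

Lemma cf_le_weight : has_closed_base BB -> cle (cf BB) (weight (CX_strong BB)).
Proof.
move=> cB; have [U [Uo Ub] Uw] := weight_basis (CX_strong BB).
have c0 : continuous (fun _ : X => 0 : R) by move=> x; exact: cvg_cst.
pose z := to_strong c0.
have [|b bP] := @choice _ _ (fun V (B : set X) => U V -> V z -> bset BB B /\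
    exists2 e : R, 0 < e & forall g, strong_ent_of B e (z, g) -> V g).
  move=> V; have [[UV Vz]|nV] := pselect (U V /\ V z); last first.
    by exists set0 => UV Vz; case: nV.
  have : nbhs z V by apply: open_nbhs_nbhs; split => //; exact: Uo.
  by move=> /nbhs_strong[B [e [BBB e0 BV]]]; exists B => _ _; split => //; exists e.
pose B0 := [set W | exists V, [/\ U V, V z & W = closure (b V)]].
have B0U : cle B0 U.
  apply: (@cle_rel_set _ _ _ _ (fun W V => W = closure (b V))).
    by move=> _ [V [UV _ ->]]; exists V.
  by move=> W W' V _ _ _ -> ->.
have bB0 : bornology_base BB B0.
  split=> [_ [V [UV Vz ->]]|A BA].
    by apply: bornology_closure => //; have [] := bP V UV Vz.
  have [|V [UV Vz] VA] := Ub z [set g | strong_ent_of A 1 (z, g)].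
    by apply/nbhs_strong; exists A, 1.
  exists (closure (b V)) => [|x Ax]; first by exists V.
  apply: contrapT => nx; have [_ [e e0 bV]] := bP V UV Vz.
  have : (~` closure (b V)) x by [].
  have : open (~` closure (b V)) by rewrite openC; exact: closed_closure.
  rewrite openE => /[apply] /nbhs_mdist[r r0 rb].
  have r20 : 0 < r / 2 by rewrite divr_gt0.
  (* Height 1 and radius [r / 2]: the tent vanishes on the [r / 2]-enlargement of [b V], so it
     belongs to [V], but its value at [x] excludes it from the 1-neighbourhood given by [A]. *)
  pose t := to_strong (@tent_continuous _ _ x _ 1 r20).
  have /VA[d d0 /(_ x)] : V t.
    apply: bV; exists (r / 2) => //= y [w bw wy].
    suff -> : (t : continuousType X R) y = 0 by rewrite subrr normr0.
    apply: tent_out => //; rewrite leNgt; apply/negP => xy.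
    apply: (rb w); last exact: subset_closure.
    apply: le_lt_trans (metric_triangle _ y _) _.
    by rewrite [r]splitr ltrD// metric_sym.
  have -> : ((z, t).2 : continuousType X R) x = 1 by exact: tent_center.
  rewrite /= sub0r normrN normr1 ltxx => H.
  by have : false by apply: H; exists x => //; rewrite mdistxx.
apply: cle_add; first exact: cle_inl.
  exact: cle_inl.
apply: cle_trans Uw; apply: cle_trans B0U.
have [|_] := @cminP (fun k => exists2 B0, bornology_base BB B0 & k = B0).
  by exists B0, B0.
by apply; exists B0.
Qed.

(** A member of the base chosen around [G i] inside its 1-neighbourhood contains no other [G j], so
    it determines [i]. *)
Lemma discrete_family_le_weight (I : Type) (G : I -> CX_strong BB) (B : set X) :
  bset BB B -> (forall i j, strong_ent_of B 1 (G i, G j) -> i = j) ->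
  cle I (weight (CX_strong BB)).
Proof.
move=> BBB GB; have [U [Uo Ub] Uw] := weight_basis (CX_strong BB).
apply: cle_trans Uw; apply: (@cle_rel_setr _ _ _ (fun i V => V (G i) /\
   forall g, V g -> strong_ent_of B 1 (G i, g))).
  move=> i; have [|V [UV VG] VB] := Ub (G i) [set g | strong_ent_of B 1 (G i, g)].
    by apply/nbhs_strong; exists B, 1.
  by exists V.
by move=> i j V _ [Vi Vi'] [Vj _]; apply: GB; exact: Vi'.
Qed.

(* Either the intersection of the [D n] has at least [m] points, or there are
injections [phi n] from [m] to [D n] that avoid it.  In the second case a point [x]
lies in finitely many [D n] only, so a natural number can record, for each of them,
whether [x] is in the image of [S] under [phi n]; the [phi n] need not have disjoint
ranges. *)
Lemma separated_functions (m : Type) (D : nat -> set X) :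
  cle nat m -> (forall n k, (n <= k)%N -> D k `<=` D n) -> (forall n, cle m (D n)) ->
  exists u : (m -> bool) -> X -> R, forall S S', S <> S' ->
    forall n, exists2 x, D n x & 1 <= `|u S x - u S' x|.
Proof.
move=> natm Dmono mD; pose Di := \bigcap_n D n.
have neqP (S S' : m -> bool) : S <> S' -> exists i, S i != S' i.
  move=> SS'; apply: contrapT => nS; apply: SS'; apply/funext => i.
  by apply/eqP; apply: contrapT => /negP Si; apply: nS; exists i.
have [/cleP[phi phi_inj]|nDi] := pselect (cle m Di).
  (* Here indicator functions of the images of subsets of [m] suffice. *)
  exists (fun S x => if `[< exists2 i, val (phi i) = x & S i >] then 1 else 0).
  move=> S S' /neqP[i Si] n; exists (val (phi i)).
    by have /set_mem := valP (phi i); apply.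
  have E (Q : m -> bool) : `[< exists2 j, val (phi j) = val (phi i) & Q j >] = Q i.
    by apply/asboolP/idP => [[j /val_inj/phi_inj ->]//|Qi]; exists i.
  by rewrite !E; case: (S i) (S' i) Si => -[]// _; rewrite ?sub0r ?subr0 ?normrN normr1.
(* [m] has the size of its square, so it embeds in one of the two parts of [D n], and not in
   [Di]. *)
have mDn n : cle m (D n `\` Di).
  have : cle (m * m) (Di + (D n `\` Di)).
    apply: cle_trans (cle_square natm) (cle_trans (mD n) _).
    apply: (@cle_rel _ _ (fun x y => match y with
      inl z => val z = val x | inr z => val z = val x end)).
      move=> x; have [Dx|nDx] := pselect (Di (val x)).
        by exists (inl (SigSub (mem_set Dx))).
      have Ex : (D n `\` Di) (val x) by split => //; exact: set_mem (valP x).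
      by exists (inr (SigSub (mem_set Ex))).
    by move=> x x' [y|y] yx yx'; apply: val_inj; rewrite -yx -yx'.
  by move=> /cle_sum_split[].
have /all_sig[phi phi_inj] : forall n, {phi : m -> (D n `\` Di) | injective phi}.
  by move=> n; apply/cid/cleP.
(* Outside [Di], the point [x] is not in [D (L x)]; as the sets decrease, [x] in [D n] forces
   [n < L x]. *)
have [|L LP] := @choice _ _ (fun x n => ~ Di x -> ~ D n x).
  move=> x; have [Dx|nDx] := pselect (Di x); first by exists 0%N.
  have [n nn] : exists n, ~ D n x.
    apply: contrapT => nn; apply: nDx => n _.
    by apply: contrapT => nDx; apply: nn; exists n.
  by exists n.
pose code (S : m -> bool) x :=
  [seq `[< exists2 i, val (phi n i) = x & S i >] | n <- iota 0 (L x)].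
exists (fun S x => (pickle (code S x))%:R) => S S' /neqP[i Si] n.
have [Dx nDx] := set_mem (valP (phi n i)); set x := val (phi n i) in Dx nDx.
exists x => //; have nL : (n < L x)%N.
  by rewrite ltnNge; apply/negP => Ln; apply: (LP _ nDx); exact: Dmono Dx.
have cSS' : code S x != code S' x.
  apply/eqP => /(congr1 (fun s => nth false s n)).
  rewrite !(nth_map 0%N) ?size_iota// nth_iota// add0n.
  have E (Q : m -> bool) : `[< exists2 j, val (phi n j) = x & Q j >] = Q i.
    by apply/asboolP/idP => [[j /val_inj/phi_inj ->]//|Qi]; exists i.
  by rewrite !E => /eqP; apply/negP.
have : pickle (code S x) != pickle (code S' x).
  by apply: contraNneq cSS' => /(pcan_inj pickleK) ->.
have lt_dist (a b : nat) : (b < a)%N -> 1 <= `|a%:R - b%:R| :> R.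
  move=> ba; rewrite ger0_norm ?subr_ge0 ?ler_nat 1?ltnW//.
  by rewrite lerBrDl natr1 ler_nat.
by rewrite neq_ltn => /orP[/lt_dist|/lt_dist//]; rewrite distrC.
Qed.

Lemma powlt_le_weight : has_closed_base BB ->
  cle (cpowlt bool (delta0s_sup BB)) (weight (CX_strong BB)).
Proof.
move=> cB; apply: cpowlt_le => m.
move=> /(@clt_csup_family _ _ (fun B => delta0s (closure B)))[B BBB mB].
have natw : cle nat (weight (CX_strong BB)) by exact: cle_inl.
(* For finite [m] the power is at most countable, and the weight is infinite. *)
have [natm|/cleNge mn] := pselect (cle nat m); last first.
  apply: cle_trans natw; apply: cle_trans (finite_cle_fun mn).
  apply: cle_fun (inhabits 0) (cle_refl _) _.
  by apply/cleP; exists (fun b : bool => (b : nat)%:Z) => -[] [].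
set P := fun k : Type => forall D : set X, closed_discrete D ->
  exists2 e : R, 0 < e & clt (D `&` enlargement (closure B) e) k.
(* Without such a [D], the cardinal [m] would belong to the class that defines [delta0s], which
   would then be at most [m]. *)
have [D dD DB] : exists2 D : set X, closed_discrete D &
    forall e : R, 0 < e -> cle m (D `&` enlargement (closure B) e).
  apply: contrapT => nD; move: mB => /cltP; apply.
  have Pm : P m.
    move=> D dD; apply: contrapT => ne; apply: nD; exists D => // e e0.
    by apply: contrapT => /cleNge De; apply: ne; exists e.
  apply: cle_add => //.
  by have [|_] := @cminP P; [exists m|apply].
pose Dn n := D `&` enlargement (closure B) n.+1%:R^-1.
have [||u uP] := @separated_functions m Dn natm.
- move=> n k nk x [Dx [b Bb bx]]; split => //; exists b => //.
  by apply: lt_le_trans bx _; rewrite lef_pV2 ?posrE// ler_nat.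
- by move=> n; apply: DB; rewrite invr_gt0.
have [|f fP] := @choice _ _ (fun (S : m -> bool) (f : X -> R) =>
    continuous f /\ forall x, D x -> f x = u S x).
  move=> S; have [f cf fu] := @discrete_extension _ _ D (u S)
    (closed_discrete_no_accumulation dD).
  by exists f.
have BBc := bornology_closure cB BBB.
apply: (@discrete_family_le_weight _ (fun S => to_strong (fP S).1) _ BBc).
move=> S S' [d d0 SS']; apply: contrapT => /uP uSS'.
(* Closeness on the [d]-enlargement is contradicted at a point of [D] closer than [d] to
   [closure B]. *)
have [n /(_ n (leqnn n)) nd] := natSinv_lt d0.
have [x [Dx [b Bb bx]]] := uSS' n.
rewrite -(fP S).2// -(fP S').2// leNgt => /negP; apply; apply: SS'.
by exists b => //; exact: lt_trans nd.
Qed.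

End lower_bound.

Theorem corollary3p16 (R : realType) (X : metricType R) (BB : bornology X)
    (BB_closed : has_closed_base BB) :
  cle (cf BB * cpowlt bool (delta0s_sup BB)) (weight (CX_strong BB)) /\
  cle (weight (CX_strong BB)) (cf BB * cpowlt bool (delta1s_sup BB)).
Proof.
split; last exact: weight_strong_le.
apply: cle_mul; first exact: cle_inl.
  exact: cf_le_weight.
exact: powlt_le_weight.
Qed.
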